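(* The hypergraph $3\text{-}QI(8,2)$ is a core.
   Context: A hypergraph $H=(V,E)$ consists of a finite set $V$ of vertices and a set $E$ of non-empty subsets of $V$ (hyperedges) whose union is $V$. A homomorphism $f:H\to H_1$ from $H=(V,E)$ to $H_1=(V_1,E_1)$ is a map $f:V\to V_1$ such that for every $e\in E$ there is $e'\in E_1$ with $f(e)\subseteq e'$ and $|f(e)|=|e|$. An endomorphism of $H$ is a homomorphism $H\to H$; an automorphism is a bijective endomorphism. $H$ is called a core if every endomorphism of $H$ is an automorphism. Definition of $3\text{-}QI(8,2)$: its vertices are all binary strings of length $8$ with entries in $\{0,1\}$ whose first entry is $0$ and in which each symbol occurs at least $4$ (hence exactly $4$) times; equivalently, the unordered partitions $\{A,\overline{A}\}$ of $[8]=\{1,\dots,8\}$ with $|A|=|\overline{A}|=4$. Three vertices $v_1,v_2,v_3$ form a hyperedge if and only if they are $3$-qualitatively independent: for every $(g_1,g_2,g_3)\in\{0,1\}^3$ there is an index $j$ with $v_i[j]=g_i$ for $i=1,2,3$ (equivalently, choosing one part $A,B,C$ from each of the three partitions, all eight intersections of the form $X\cap Y\cap Z$ with $X\in\{A,\overline A\}$, $Y\in\{B,\overline B\}$, $Z\in\{C,\overline C\}$ are non-empty). There are no other hyperedges. *)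

(* Defs.v *)
From mathcomp Require Import all_boot.

Set Implicit Arguments.
Unset Strict Implicit.
Unset Printing Implicit Defensive.

Record hypergraph := Hypergraph {
  vertex :> finType;
  hyperedges : {set {set vertex}};
  hyperedges_neq0 : set0 \notin hyperedges;
  hyperedges_cover : cover hyperedges = [set: vertex]
}.

Definition hom (H H1 : hypergraph) (f : H -> H1) : Prop :=
  forall e, e \in hyperedges H ->
    exists2 e', e' \in hyperedges H1 & f @: e \subset e' /\ #|f @: e| = #|e|.

Definition endomorphism (H : hypergraph) (f : H -> H) : Prop := hom f.

Definition automorphism (H : hypergraph) (f : H -> H) : Prop :=
  endomorphism f /\ bijective f.

Definition is_core (H : hypergraph) : Prop :=
  forall f : H -> H, endomorphism f -> automorphism f.

(* The symbols 0 and 1 are encoded as false and true. *)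
Definition balanced (v : 8.-tuple bool) : bool :=
  (tnth v ord0 == false) && [forall b : bool, 4 <= count_mem b v].

Definition string8 : finType := {v : 8.-tuple bool | balanced v}.

Definition qual_indep3 (v1 v2 v3 : string8) : bool :=
  [forall g1 : bool, forall g2 : bool, forall g3 : bool, exists j : 'I_8,
    [&& tnth (val v1) j == g1, tnth (val v2) j == g2 & tnth (val v3) j == g3]].

(* Qualitatively independent v1, v2, v3 are pairwise distinct, so these sets
   all have exactly three elements. *)
Definition QI3_edges : {set {set string8}} :=
  [set e : {set string8} | [exists v1 : string8, exists v2 : string8,
     exists v3 : string8, (e == [set v1; v2; v3]) && qual_indep3 v1 v2 v3]].

Lemma QI3_edges_neq0 : set0 \notin QI3_edges.
Proof.
rewrite inE; apply/existsP => -[v1 /existsP[v2 /existsP[v3 /andP[/eqP E _]]]].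
have : v1 \in [set v1; v2; v3] by rewrite !inE eqxx.
by rewrite -E inE.
Qed.

Section Cover.

(* Every vertex v lies in a hyperedge: complete v by the two strings giving the
   low and high bits of the rank of position j among the positions carrying the
   same symbol of v as j. *)

Let rank (s : seq bool) j := count_mem (nth false s j) (take j s).
Let sbit1 s := mkseq (fun j => odd (rank s j)) 8.
Let sbit2 s := mkseq (fun j => odd (rank s j)./2) 8.
Let sbal (s : seq bool) :=
  [&& nth false s 0 == false, 4 <= count_mem true s & 4 <= count_mem false s].
Let sqi (s1 s2 s3 : seq bool) :=
  all (fun g1 => all (fun g2 => all (fun g3 => has (fun j =>
    [&& nth false s1 j == g1, nth false s2 j == g2 & nth false s3 j == g3])
    (iota 0 8)) [:: true; false]) [:: true; false]) [:: true; false].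

Let sbits_ok (s : seq bool) : size s = 8 -> sbal s ->
  [&& sbal (sbit1 s), sbal (sbit2 s) & sqi s (sbit1 s) (sbit2 s)].
Proof.
case: s => [|a [|b [|c [|d [|e [|f [|g [|h [|i s]]]]]]]]] // _.
by case: a b c d e f g h => [] [] [] [] [] [] [] []; vm_compute.
Qed.

Let balancedE (v : 8.-tuple bool) : balanced v = sbal v.
Proof.
rewrite /balanced /sbal (tnth_nth false); congr (_ && _).
by apply/forallP/andP => [P|[P Q] []] //; split; apply: P.
Qed.

Let sqiP (v1 v2 v3 : string8) :
  sqi (val v1) (val v2) (val v3) -> qual_indep3 v1 v2 v3.
Proof.
have inb (b : bool) : b \in [:: true; false] by case: b.
move=> S; apply/'forall_'forall_forallP => g1 g2 g3.
have /allP/(_ _ (inb g2))/allP/(_ _ (inb g3))/hasP[j] :=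
  allP S _ (inb g1).
rewrite mem_iota add0n => /= jlt P; apply/existsP; exists (Ordinal jlt).
by rewrite !(tnth_nth false).
Qed.

Lemma QI3_edges_cover : cover QI3_edges = [set: string8].
Proof.
apply/setP => v; rewrite inE; apply/bigcupP.
have := valP v; rewrite balancedE => /(sbits_ok (size_tuple _)).
case/and3P => B1 B2 Q.
have s1 : size (sbit1 (val v)) == 8 by rewrite size_mkseq.
have s2 : size (sbit2 (val v)) == 8 by rewrite size_mkseq.
have b1 : balanced (Tuple s1) by rewrite balancedE.
have b2 : balanced (Tuple s2) by rewrite balancedE.
exists [set v; Sub _ b1; Sub _ b2]; last by rewrite !inE eqxx.
rewrite inE; apply/existsP; exists v; apply/existsP; exists (Sub _ b1).
by apply/existsP; exists (Sub _ b2); rewrite eqxx /=; apply: sqiP.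
Qed.

End Cover.

Definition QI3_8_2 : hypergraph := Hypergraph QI3_edges_neq0 QI3_edges_cover.

(* Main.v *)
Require Import Defs.
From mathcomp Require Import all_boot.

Set Implicit Arguments.
Unset Strict Implicit.
Unset Printing Implicit Defensive.

(** The words of length 8 and even weight that begin with 0 form a vector space
    of dimension 6 over the field with two elements: they represent the even
    subsets of the eight positions, modulo complementation. On it, half the
    weight modulo 2 is a quadratic form q; its polar form is the parity of the
    overlap of two words, and its 35 nonzero singular vectors are the words of
    weight 4, that is, the vertices. They are the points of the Klein quadric,
    whose totally singular planes are Fano planes, with 7 points each.

    Three vertices form a hyperedge exactly when their seven nonzero linear
    combinations all have weight 4, that is, when they span a totally singular
    plane ([qual_indep3E]). An endomorphism f therefore maps the non-collinear
    triples of each such plane to non-collinear triples of another, so it maps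
    lines to lines: f (a + b) = f a + f b whenever a and b are perpendicular
    ([word_endo_add]).

    This forces f to be injective ([word_endo_inj]). Suppose that f a = f b with
    a and b distinct. Then a and b are not perpendicular, so p = a + b is
    nonsingular, and f x = f (x + p) whenever x and x + p are both singular
    ([word_endo_translate]): f acts as a linear map that kills p. Now let x and y
    be distinct singular vectors orthogonal to p. Either x + y or x + y + p is
    singular, because q p = 1, and so f x + f y is a value of f, hence singular
    ([word_endo_polar_perp]). The 15 singular vectors orthogonal to p would thus
    have distinct, pairwise perpendicular images; but pairwise perpendicular
    points lie in one totally singular plane, so there are at most 7 of them
    ([clique_size]). Finally, an injective map of a finite set to itself is a
    bijection. *)

(** * Binary words *)

Fixpoint words n : seq (seq bool) :=
  if n is n'.+1 then
    [seq false :: w | w <- words n'] ++ [seq true :: w | w <- words n']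
  else [:: [::]].

Lemma mem_words n w : size w = n -> w \in words n.
Proof.
elim: n w => [|n IHn] [|b w] //= [/IHn w_n].
by rewrite mem_cat; case: b; rewrite !map_f ?orbT.
Qed.

Lemma mem_filter_words n (P : pred (seq bool)) w :
  (forall v, P v -> size v = n) -> (w \in [seq v <- words n | P v]) = P w.
Proof.
move=> sizeP; rewrite mem_filter; case: (boolP (P w)) => // /sizeP.
exact: mem_words.
Qed.

Definition addw (a b : seq bool) : seq bool :=
  [seq x.1 (+) x.2 | x <- zip a b].

Local Notation "a [+] b" := (addw a b) (at level 50, left associativity).

Lemma addwC : commutative addw.
Proof.
elim=> [|x a IHa] [|y b] //.
by congr cons; [apply: addbC | apply: IHa].
Qed.

Lemma addwA : associative addw.
Proof.
elim=> [|x a IHa] [|y b] [|z c] //.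
by congr cons; [apply: addbA | apply: IHa].
Qed.

Lemma addwK a b : size a = size b -> a [+] b [+] b = a.
Proof.
elim: a b => [|x a IHa] [|y b] //= [eq_sz].
by congr cons; [apply: addbK | apply: IHa].
Qed.

Lemma addwACA a b c d : a [+] b [+] (c [+] d) = a [+] c [+] (b [+] d).
Proof. by rewrite -!addwA (addwA b) (addwC b) -addwA. Qed.

Lemma size_addw a b : size (a [+] b) = minn (size a) (size b).
Proof. by rewrite size_map size_zip. Qed.

Lemma addw_map (T : Type) (f g : T -> bool) s :
  map f s [+] map g s = [seq f x (+) g x | x <- s].
Proof. by elim: s => //= x s IHs; congr cons. Qed.

(** * Points of the Klein quadric *)

(** These are the nonzero singular vectors of the form q. *)
Definition point (w : seq bool) : bool :=
  [&& size w == 8, ~~ head true w & count id w == 4].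

Definition points := [seq w <- words 8 | point w].

Lemma size_point a : point a -> size a = 8.
Proof. by case/and3P => /eqP. Qed.

Lemma mem_points w : (w \in points) = point w.
Proof. exact: mem_filter_words size_point. Qed.

(** For points a and b this says that they are distinct and orthogonal, since
    q (a + b) = q a + q b + B a b for the polar form B of q. *)
Definition perp a b := point (a [+] b).

Lemma perpC a b : perp a b = perp b a.
Proof. by rewrite /perp addwC. Qed.

Lemma perp_irrefl a : perp a a = false.
Proof.
apply/and3P => -[_ _]; suff ->: count id (a [+] a) = 0 by [].
by elim: a => //= x a IHa; rewrite addbb.
Qed.

Definition span3 a b c : seq (seq bool) :=
  [:: a; b; c; a [+] b; b [+] c; a [+] c; a [+] b [+] c].

(** A triangle is a basis of a totally singular plane: a dependent triple has the
    zero word among its combinations. *)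
Definition triangle a b c := all point (span3 a b c).

Lemma triangle_perp a b c : triangle a b c ->
  [/\ point a, point b, point c & [/\ perp b a, perp c a & perp c b]].
Proof.
case/and5P => Pa Pb Pc ab /and4P[bc ac _ _].
by split=> //; split; rewrite perpC.
Qed.

Lemma triangle_not_line a b c : triangle a b c -> c != a [+] b.
Proof.
case/and5P => _ _ _ _ /and4P[_ _ abc _]; apply: contraTneq abc => ->.
by rewrite -/(perp _ _) perp_irrefl.
Qed.

Lemma triangle_swap12 a b c : triangle a b c -> triangle b a c.
Proof.
case/and5P => Pa Pb Pc Pab /and4P[Pbc Pac Pabc _].
by rewrite /triangle /= [b [+] a]addwC Pa Pb Pc Pab Pbc Pac Pabc.
Qed.

Lemma triangle_swap23 a b c : triangle a b c -> triangle a c b.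
Proof.
case/and5P => Pa Pb Pc Pab /and4P[Pbc Pac Pabc _].
rewrite /triangle /= -addwA [c [+] b]addwC addwA.
by rewrite Pa Pb Pc Pab Pbc Pac Pabc.
Qed.

Definition nbhd a s := [seq x <- s | (x == a) || perp x a].

(** * Qualitative independence of words *)

Definition bool3 : seq (bool * (bool * bool)) :=
  [seq (x, yz) | x <- [:: true; false],
     yz <- [seq (y, z) | y <- [:: true; false], z <- [:: true; false]]].

Definition columns (a b c : seq bool) := zip a (zip b c).

Definition indep a b c := all (mem (columns a b c)) bool3.

(** There are only eight columns, so if all eight patterns occur, each does
    exactly once. A nonzero linear combination of the three rows then takes the
    value 1 on four of the columns. *)
Lemma indep_triangle a b c : point a -> point b -> point c ->
  indep a b c -> triangle a b c.
Proof.
move=> Pa Pb Pc /allP abc.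
have [[sza szb] szc] := (size_point Pa, size_point Pb, size_point Pc).
have sz2 : size (zip b c) = 8 by rewrite size_zip szb szc.
have sz3 : size (columns a b c) = 8 by rewrite size_zip sza sz2.
have perm_abc : perm_eq (columns a b c) bool3.
  have [|_ mem_abc] := @uniq_min_size _ bool3 _ isT abc; first by rewrite sz3.
  rewrite perm_sym uniq_perm //.
  by apply: (@leq_size_uniq _ bool3) abc _; rewrite // sz3.
have point_map f : ~~ head true (map f (columns a b c)) ->
    count f bool3 == 4 -> point (map f (columns a b c)).
  by move=> hd c4; rewrite /point size_map sz3 hd count_map (permP perm_abc).
have hd x y : size x = 8 -> size y = 8 -> ~~ head true x -> ~~ head true y ->
    ~~ head true (x [+] y).
  by case: x y => [|[] x] [|[] y].
have [[[_ ha _] [_ hb _]] [_ hc _]] := (and3P Pa, and3P Pb, and3P Pc).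
have Ea : a = map fst (columns a b c).
  by rewrite -[LHS](@unzip1_zip _ _ _ (zip b c)) ?sza ?sz2.
have Ebc : zip b c = unzip2 (columns a b c) by rewrite unzip2_zip // sza sz2.
have Eb : b = map (fun t => t.2.1) (columns a b c).
  rewrite -[LHS](@unzip1_zip _ _ b c) ?szb ?szc // Ebc.
  by rewrite /unzip1 /unzip2 -map_comp.
have Ec : c = map (fun t => t.2.2) (columns a b c).
  rewrite -[LHS](@unzip2_zip _ _ b c) ?szb ?szc // Ebc.
  by rewrite /unzip2 -map_comp.
set s := columns a b c in point_map Ea Eb Ec.
have hab := hd _ _ sza szb ha hb; have hbc := hd _ _ szb szc hb hc.
have hac := hd _ _ sza szc ha hc.
have h3 : ~~ head true (a [+] b [+] c).
  by apply: hd; rewrite ?size_addw ?sza ?szb.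
clearbody s; rewrite /triangle /= Pa Pb Pc /=; apply/and5P; split=> //.
- by rewrite Ea Eb addw_map point_map // -addw_map -Ea -Eb.
- by rewrite Eb Ec addw_map point_map // -addw_map -Eb -Ec.
- by rewrite Ea Ec addw_map point_map // -addw_map -Ea -Ec.
- by rewrite Ea Eb Ec !addw_map point_map // -!addw_map -Ea -Eb -Ec.
Qed.

(** The weights of a, b, c and of their sums determine how many columns show each
    pattern (invert the character table of the group of patterns): one each.
    Here this is checked over all triangles. *)
Lemma triangle_indep a b c : triangle a b c -> indep a b c.
Proof.
move=> tabc; have [Pa Pb Pc [ba ca cb]] := triangle_perp tabc.
rewrite -!mem_points in Pa Pb Pc.
have /allP/(_ a Pa)/allP/(_ b) :
  all (fun a => let na := nbhd a points in
    all (fun b => all (fun c => triangle a b c ==> indep a b c) (nbhd b na))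
      na) points.
  by vm_cast_no_check (erefl true).
rewrite mem_filter ba orbT => /(_ Pb)/allP/(_ c).
by rewrite 2!mem_filter ca cb tabc !orbT; apply.
Qed.

(** * Planes and cliques *)

(** Two perpendicular points extend to a triangle a, b, c. In the plane of this
    triangle, g is the point on none of its sides, d is the third point of the
    side a b, and the listed triples are some of the non-collinear ones: by
    [line_of_triangles] they determine g, and then d, from a, b and c. *)
Lemma plane_triangles a b : point a -> point b -> perp a b ->
  exists c, let d := a [+] b in let g := a [+] b [+] c in
    [/\ triangle a b c,
        [/\ triangle a b g, triangle b c g & triangle a c g] &
        [/\ triangle b c d, triangle a c d & triangle a d g]].
Proof.
rewrite -!mem_points => Pa Pb ab.
have /allP/(_ a Pa)/allP/(_ b) :
  all (fun a => all (fun b => if perp a b then has (fun c =>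
      let d := a [+] b in let g := a [+] b [+] c in
      if triangle a b c then
        [&& triangle a b g, triangle b c g & triangle a c g] &&
        [&& triangle b c d, triangle a c d & triangle a d g]
      else false) points else true) points) points.
  by vm_cast_no_check (erefl true).
rewrite ab => /(_ Pb)/hasP[c _] /=; case: ifP => // t.
by case/andP => /and3P[t1 t2 t3] /and3P[]; exists c.
Qed.

(** A totally singular subspace has dimension at most 3, because q is
    nondegenerate in dimension 6. *)
Lemma plane_maximal a b c d : point a -> point b -> point c -> point d ->
  perp b a -> perp c a -> perp c b -> c != a [+] b ->
  (d == a) || perp d a -> (d == b) || perp d b -> (d == c) || perp d c ->
  d \in span3 a b c.
Proof.
rewrite -!mem_points => Pa Pb Pc Pd ba ca cb cab da db dc.
have /allP/(_ a Pa)/allP/(_ b) :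
  all (fun a => let na := nbhd a points in all (fun b =>
    if perp b a then let nb := nbhd b na in all (fun c => 
      if [&& perp c a, perp c b & c != a [+] b] then
        all (mem (span3 a b c)) (nbhd c nb) else true) nb else true) na) points.
  by vm_cast_no_check (erefl true).
rewrite mem_filter ba orbT => /(_ Pb)/allP/(_ c).
rewrite 2!mem_filter ca cb cab !orbT => /(_ Pc)/allP/(_ d).
by rewrite 3!mem_filter da db dc; apply.
Qed.

(** Both g and d are in the plane of a, b, c by maximality. The first three
    conditions take g off the sides of the triangle, so g = a + b + c; the others
    then leave d no other place than the third point of the side a b. *)
Lemma line_of_triangles a b c d g :
  triangle a b c ->
  [/\ triangle a b g, triangle b c g & triangle a c g] ->
  [/\ triangle b c d, triangle a c d & triangle a d g] ->
  d = a [+] b.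
Proof.
move=> tabc [tabg tbcg tacg] [tbcd tacd tadg].
have [Pa Pb Pc [ba ca cb]] := triangle_perp tabc.
have [_ _ Pg [_ ga gb]] := triangle_perp tabg.
have [_ _ _ [_ _ gc]] := triangle_perp tbcg.
have [_ _ Pd [_ db dc]] := triangle_perp tbcd.
have [_ _ _ [da _ gd]] := triangle_perp tadg.
have ne x y : perp x y -> (x == y) = false.
  by apply: contraTF => /eqP->; rewrite perp_irrefl.
have cab := triangle_not_line tabc.
have := @plane_maximal a b c g; rewrite ga gb gc !orbT.
move=> /(_ Pa Pb Pc Pg ba ca cb cab isT isT isT).
rewrite !inE (ne _ _ ga) (ne _ _ gb) (ne _ _ gc).
rewrite (negPf (triangle_not_line tabg)) (negPf (triangle_not_line tbcg)).
rewrite (negPf (triangle_not_line tacg)) => /eqP g_abc.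
have := @plane_maximal a b c d; rewrite da db dc !orbT.
move=> /(_ Pa Pb Pc Pd ba ca cb cab isT isT isT).
rewrite !inE -g_abc [d == g]eq_sym.
rewrite (ne _ _ da) (ne _ _ db) (ne _ _ dc) (ne _ _ gd).
rewrite (negPf (triangle_not_line tbcd)).
by rewrite (negPf (triangle_not_line tacd)) !orbF => /eqP.
Qed.

(** Either the points are on one line, or three of them form a triangle and the
    others are in its plane. *)
Lemma clique_size s : uniq s -> all point s ->
  {in s &, forall a b, a != b -> perp a b} -> size s <= 7.
Proof.
case: s => [|a [|b s]] // uniq_s /allP Ps perp_s.
have Sa : a \in [:: a, b & s] by rewrite mem_head.
have Sb : b \in [:: a, b & s] by rewrite !inE eqxx orbT.
have ab : a != b by case/andP: uniq_s; rewrite inE negb_or => /andP[].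
have [line_s|/allPn[c Sc]] :=
  boolP (all (mem [:: a; b; a [+] b]) [:: a, b & s]).
  by apply: leq_trans (uniq_leq_size uniq_s (allP line_s)) _.
rewrite !inE !negb_or => /and3P[ca cb cab].
have eq_or_perp d e : d \in [:: a, b & s] -> e \in [:: a, b & s] ->
    (d == e) || perp d e.
  by move=> Sd Se; case: eqVneq => //= de; apply: perp_s.
suff /(uniq_leq_size uniq_s): {subset [:: a, b & s] <= span3 a b c} by [].
move=> d Sd.
have [[da db] dc] :=
  (eq_or_perp d a Sd Sa, eq_or_perp d b Sd Sb, eq_or_perp d c Sd Sc).
apply: plane_maximal da db dc => //; rewrite ?Ps //; apply: perp_s => //.
by rewrite eq_sym.
Qed.

(** * Nonsingular vectors and their polar hyperplanes *)

(** These are the vectors with q p = 1: even weight, but not divisible by 4. *)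
Definition nonsingular p :=
  [&& size p == 8, ~~ head true p & count id p \in [:: 2; 6]].

Definition nonsingulars := [seq p <- words 8 | nonsingular p].

Lemma mem_nonsingulars p : (p \in nonsingulars) = nonsingular p.
Proof. by apply: mem_filter_words => v /and3P[/eqP]. Qed.

Lemma add_nonperp a b : point a -> point b -> a != b -> ~~ perp a b ->
  nonsingular (a [+] b).
Proof.
rewrite -!mem_points => Pa Pb ab nab.
have /allP/(_ a Pa)/allP/(_ b Pb) :
  all (fun a => all (fun b =>
    [|| a == b, perp a b | nonsingular (a [+] b)]) points) points.
  by vm_cast_no_check (erefl true).
by rewrite (negPf ab) (negPf nab).
Qed.

(** Here a + b is nonsingular, so that x + (a + b) is singular exactly when x is
    not orthogonal to a + b; then x is orthogonal to exactly one of a and b. *)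
Lemma perp_addl_or a b x : point a -> point b -> a != b -> ~~ perp a b ->
  point x -> perp x (a [+] b) -> (x == a) || perp x a || ((x == b) || perp x b).
Proof.
rewrite -!mem_points => Pa Pb ab nab Px xp.
have /allP/(_ a Pa)/allP/(_ b Pb) :
  all (fun a => all (fun b => if (a == b) || perp a b then true else
    all (fun x => if perp x (a [+] b)
      then (x == a) || perp x a || ((x == b) || perp x b) else true) points)
    points) points.
  by vm_cast_no_check (erefl true).
by rewrite (negPf ab) (negPf nab) => /allP/(_ x Px); rewrite xp.
Qed.

(** For nonsingular p, these are the points orthogonal to p, despite the
    negation: q (x + p) = 1 + B x p is zero exactly when B x p = 1. *)
Definition polar p := [seq x <- points | ~~ perp x p].

Lemma mem_polar p x : (x \in polar p) = ~~ perp x p && point x.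
Proof. by rewrite mem_filter mem_points. Qed.

(** The vector u, orthogonal to x and y but not to p, gives x = u + (u + x) and
    y = u + (u + y) as sums of perpendicular points; translating u + x by p makes
    it perpendicular to u + y, their sum being the point x + y + p. *)
Lemma polar_bridge p x y : nonsingular p -> x \in polar p -> y \in polar p ->
  x != y -> ~~ perp x y ->
  exists u, [/\ point u, perp u x, perp u y,
                perp (u [+] x) p & perp (u [+] x [+] p) (u [+] y)].
Proof.
rewrite -mem_nonsingulars => Np Sx Sy xy nxy.
have /allP/(_ p Np)/allP/(_ x Sx)/allP/(_ y Sy) :
  all (fun p => let S := polar p in all (fun x => all (fun y =>
    if x == y then true else if perp x y then true else
    has (fun u => if perp u x && perp u y then
            perp (u [+] x) p && perp (u [+] x [+] p) (u [+] y) else false)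
      points) S) S) nonsingulars.
  by vm_cast_no_check (erefl true).
rewrite (negPf xy) (negPf nxy) => /hasP[u Pu].
case: ifP => // /andP[ux uy] /andP[uxp uxpuy].
by rewrite mem_points in Pu; exists u.
Qed.

(** The polar hyperplane of p meets the Klein quadric in a parabolic quadric. *)
Lemma size_polar p : nonsingular p -> size (polar p) = 15.
Proof.
rewrite -mem_nonsingulars => Np; apply/eqP; move: p Np; apply/allP.
by vm_cast_no_check (erefl true).
Qed.

(** * Triangle-preserving maps are injective *)

Definition word_endo (F : seq bool -> seq bool) :=
  {homo F : a / point a} /\
  forall a b c, triangle a b c -> triangle (F a) (F b) (F c).

(** The plane of a triangle maps to the plane of its image, and non-collinear
    triples to non-collinear triples. *)
Lemma word_endo_add F a b : word_endo F -> point a -> point b -> perp a b ->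
  F (a [+] b) = F a [+] F b.
Proof.
move=> [_ F3] Pa Pb /(plane_triangles Pa Pb)[c [t [t1 t2 t3] [t4 t5 t6]]].
by apply: (line_of_triangles (F3 _ _ _ t) (g := F (a [+] b [+] c)));
   split; apply: F3.
Qed.

(** If x is orthogonal to a, then so is x + a to b, and additivity gives
    F (x + a + b) = F x + F a + F b = F x. *)
Lemma word_endo_translate F a b x : word_endo F ->
  point a -> point b -> a != b -> ~~ perp a b -> F a = F b -> point x ->
  perp x (a [+] b) -> F (x [+] (a [+] b)) = F x.
Proof.
move=> Fe Pa Pb ab nab Fab Px xp; have [FP _] := Fe.
wlog xa : a b Pa Pb ab nab Fab xp / (x == a) || perp x a.
  move=> IH; have /orP[|xb] := perp_addl_or Pa Pb ab nab Px xp; first exact: IH.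
  rewrite (addwC a); apply: IH => //.
  - by rewrite eq_sym.
  - by rewrite perpC.
  - by rewrite addwC.
case/orP: xa => [/eqP->|xa].
  by rewrite (addwC a) (addwC a b) addwK // !size_point.
rewrite /perp addwA in xp; rewrite addwA.
by rewrite !(word_endo_add Fe) // Fab addwK // !size_point //; apply: FP.
Qed.

(** With p = a + b, the sum F x + F y is F (x + y) or F (x + y + p), whichever of
    x + y and x + y + p is a point. *)
Lemma word_endo_polar_perp F a b x y : word_endo F ->
  point a -> point b -> a != b -> ~~ perp a b -> F a = F b ->
  x \in polar (a [+] b) -> y \in polar (a [+] b) -> x != y -> perp (F x) (F y).
Proof.
move=> Fe Pa Pb ab nab Fab Sx Sy xy; have [FP _] := Fe.
have [Px Py]: point x /\ point y.
  by move: Sx Sy; rewrite !mem_polar => /andP[_ ?] /andP[].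
have [xy'|nxy] := boolP (perp x y).
  by rewrite /perp -(word_endo_add Fe) //; apply: FP.
have [u [Pu ux uy uxp uxpuy]] :=
  polar_bridge (add_nonperp Pa Pb ab nab) Sx Sy xy nxy.
rewrite /perp.
suff ->: F x [+] F y = F (u [+] x [+] (a [+] b) [+] (u [+] y)) by apply: FP.
rewrite (word_endo_add Fe) // word_endo_translate // !(word_endo_add Fe) //.
rewrite addwACA (addwC (F u [+] F u)) addwA addwK //.
  by rewrite !size_addw !size_point //; apply: FP.
Qed.

Lemma word_endo_inj F a b : word_endo F -> point a -> point b -> F a = F b ->
  a = b.
Proof.
move=> Fe Pa Pb Fab; apply/eqP; apply: contraT => ab; have [FP F3] := Fe.
have nab : ~~ perp a b.
  apply/negP => pab; have := FP _ pab; rewrite (word_endo_add Fe) // Fab.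
  by rewrite -/(perp _ _) perp_irrefl.
have polar_perp := word_endo_polar_perp Fe Pa Pb ab nab Fab.
suff: size (map F (polar (a [+] b))) <= 7.
  by rewrite size_map size_polar //; apply: add_nonperp.
apply: clique_size.
- rewrite map_inj_in_uniq ?filter_uniq // => x y Sx Sy Fxy.
  apply/eqP; apply: contraT => xy; have := polar_perp x y Sx Sy xy.
  by rewrite Fxy perp_irrefl.
- apply/allP => _ /mapP[x + ->]; rewrite mem_polar => /andP[_].
  exact: FP.
move=> _ _ /mapP[x Sx ->] /mapP[y Sy ->] Fxy; apply: polar_perp => //.
by apply: contraNneq Fxy => ->.
Qed.

(** * From words to the hypergraph *)

Lemma balancedE (w : 8.-tuple bool) : balanced w = point w.
Proof.
rewrite /balanced /point size_tuple eqxx /= (tnth_nth false) nth0 eqbF_neg.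
have ->: head false w = head true w by case: (tupleP w).
congr (_ && _); have := count_predC id w; rewrite size_tuple => sz.
have cT : count_mem true w = count id w by apply: eq_count => -[].
have cF : count_mem false w = count (predC id) w by apply: eq_count => -[].
apply/forallP/eqP => [P|P b].
  have := P false.
  rewrite cF -(leq_add2l (count id w)) sz (leq_add2r 4 _ 4) => le4.
  by apply/eqP; rewrite eqn_leq le4 -cT P.
have d4 : count (predC id) w = 4.
  by apply/eqP; rewrite -(eqn_add2l 4) -[X in X + _]P sz.
by case: b; rewrite ?cT ?cF ?P ?d4.
Qed.

Lemma point_val (v : string8) : point (val (val v)).
Proof. by rewrite -balancedE; apply: valP. Qed.

Lemma qual_indep3E (v1 v2 v3 : string8) :
  qual_indep3 v1 v2 v3 = triangle (val (val v1)) (val (val v2)) (val (val v3)).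
Proof.
have -> : triangle (val (val v1)) (val (val v2)) (val (val v3)) =
          indep (val (val v1)) (val (val v2)) (val (val v3)).
  apply/idP/idP => [/triangle_indep|/indep_triangle] //.
  by apply; apply: point_val.
rewrite /qual_indep3 /indep /columns.
set w1 := val v1; set w2 := val v2; set w3 := val v3.
apply/'forall_'forall_forallP/allP => [P [g1 [g2 g3]] _|P g1 g2 g3].
  have /existsP[j /and3P[/eqP<- /eqP<- /eqP<-]] := P g1 g2 g3.
  rewrite !(tnth_nth false) /= -!nth_zip ?size_zip ?size_tuple //.
  by rewrite mem_nth // !size_zip !size_tuple.
have : (g1, (g2, g3)) \in zip w1 (zip w2 w3).
  by apply: P; case: g1 g2 g3 => [] [] [].
case/(nthP (false, (false, false))) => j; rewrite !size_zip !size_tuple => lt_j.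
rewrite !nth_zip ?size_zip ?size_tuple // => -[<- <- <-].
by apply/existsP; exists (Ordinal lt_j); rewrite !(tnth_nth false) !eqxx.
Qed.

Lemma cards3_uniq (T : finType) (x y z : T) :
  (#|[set x; y; z]| == 3) = uniq [:: x; y; z].
Proof.
have -> : #|[set x; y; z]| = #|[:: x; y; z]|.
  by apply: eq_card => t; rewrite !inE orbA.
by apply/eqP/idP => [/card_uniqP|/card_uniqP].
Qed.

Lemma cards3_le (T : finType) (x y z : T) : #|[set x; y; z]| <= 3.
Proof.
by rewrite (leq_trans (leq_card_setU _ _)) // cards2 cards1; case: (x == y).
Qed.

Lemma mem_edge (v1 v2 v3 : string8) :
  qual_indep3 v1 v2 v3 -> [set v1; v2; v3] \in QI3_edges.
Proof.
move=> Q; rewrite inE; apply/existsP; exists v1; apply/existsP; exists v2.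
by apply/existsP; exists v3; rewrite eqxx.
Qed.

Lemma qual_indep3_uniq (v1 v2 v3 : string8) :
  qual_indep3 v1 v2 v3 -> uniq [:: v1; v2; v3].
Proof.
rewrite qual_indep3E => /triangle_perp[_ _ _ [p21 p31 p32]].
have ne (u v : string8) : perp (val (val u)) (val (val v)) -> v != u.
  by apply: contraTneq => ->; rewrite perp_irrefl.
by rewrite /= !inE !negb_or (ne _ _ p21) (ne _ _ p31) (ne _ _ p32).
Qed.

(** A hyperedge lists its vertices in some order, and being a triangle does not
    depend on the order. *)
Lemma edge_qual_indep3 (v1 v2 v3 : string8) : uniq [:: v1; v2; v3] ->
  [set v1; v2; v3] \in QI3_edges -> qual_indep3 v1 v2 v3.
Proof.
rewrite /= !inE !negb_or !andbT => /andP[/andP[n12 n13] n23].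
case/existsP => w1 /existsP[w2 /existsP[w3 /andP[/eqP/setP E]]].
rewrite !qual_indep3E => t.
have [t12 t23] := (triangle_swap12, triangle_swap23).
have := E v1; have := E v2; have := E v3; rewrite !inE !eqxx !orbT /=.
move/esym/orP => [/orP[]|] /eqP D3 /esym/orP[/orP[]|] /eqP D2;
  move=> /esym/orP[/orP[]|] /eqP D1;
  move: n12 n13 n23; subst; rewrite ?eqxx // => _ _ _; auto.
Qed.

(** At words that are not vertices the value is the default [::]. *)
Definition word_map (f : string8 -> string8) (w : seq bool) : seq bool :=
  if [pick v : string8 | val (val v) == w] is Some v then val (val (f v))
  else [::].

Lemma word_map_val f v : word_map f (val (val v)) = val (val (f v)).
Proof.
rewrite /word_map; case: pickP => [u /eqP/val_inj/val_inj-> //|/(_ v)].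
by rewrite eqxx.
Qed.

Lemma pointP w : point w -> exists v : string8, val (val v) = w.
Proof.
move=> Pw; have sz : size w == 8 by case/and3P: Pw.
have b : balanced (Tuple sz) by rewrite balancedE.
by exists (Sub (Tuple sz) b).
Qed.

(** The image of a hyperedge has three elements and lies in a hyperedge, which has
    at most three: so it is a hyperedge. *)
Lemma word_map_endo (f : QI3_8_2 -> QI3_8_2) : endomorphism f ->
  word_endo (word_map f).
Proof.
move=> fE; split=> [_ /pointP[v <-]|a b c t].
  by rewrite word_map_val point_val.
have [/pointP[u Eu] /pointP[v Ev] /pointP[w Ew] _] := triangle_perp t.
rewrite -Eu -Ev -Ew in t *.
move: t; rewrite !word_map_val -!qual_indep3E => Q.
have [e' e'E [sub_e' card_e]] := fE _ (mem_edge Q).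
have card3 : #|f @: [set u; v; w]| = 3.
  by rewrite card_e; apply/eqP; rewrite cards3_uniq; apply: qual_indep3_uniq.
have im : f @: [set u; v; w] = [set f u; f v; f w].
  by rewrite !imsetU !imset_set1.
rewrite im in card3 sub_e'.
apply: edge_qual_indep3; first by rewrite -cards3_uniq card3.
suff -> : [set f u; f v; f w] = e' by [].
apply/eqP; rewrite eqEcard sub_e' card3.
move: e'E; rewrite inE => /existsP[x /existsP[y /existsP[z /andP[/eqP-> _]]]].
exact: cards3_le.
Qed.

Theorem theorem4 : is_core QI3_8_2.
Proof.
move=> f fE; split=> //; apply: injF_bij => u v fuv.
apply/val_inj/val_inj; apply: (word_endo_inj (word_map_endo fE)).
- exact: point_val.
- exact: point_val.
by rewrite !word_map_val fuv.
Qed.
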